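(* Let $\alpha\in(0,1)$, $a<b$, let $A\in\mathbb{R}^{d\times d}$ be a real symmetric matrix, $B\in\mathbb{R}^{d\times N}$ a real matrix, and let $g\in C([a,b];\mathbb{R})$ satisfy $g(t)\neq0$ for almost every $t\in[a,b]$. Let $y_0\in\mathbb{R}^d$. The system $$ {}_a^C\mathrm{D}_t^{\alpha}y(t)=A g(t)y(t)+Bu(t),\quad t\in[a,b],\qquad y(a)=y_0, $$ is controllable if and only if the adjoint system $$ {}_t\mathrm{D}_b^{\alpha}z(t)=Ag(t)z(t),\quad t\in[a,b],\qquad {}_t\mathrm{I}_b^{1-\alpha}z(t)|_{t=b}=z_b, $$ is observable.
   Context: Left Riemann-Liouville integral: ${}_a\mathrm{I}_t^{\alpha}\varphi(t)=\frac{1}{\Gamma(\alpha)}\int_a^t(t-s)^{\alpha-1}\varphi(s)\,ds$. Left Caputo derivative: ${}_a^C\mathrm{D}_t^{\alpha}\varphi(t)=\frac{1}{\Gamma(1-\alpha)}\int_a^t\frac{\varphi'(s)}{(t-s)^{\alpha}}\,ds$. Right Riemann-Liouville integral and derivative: ${}_t\mathrm{I}_b^{\beta}\varphi(t)=\frac1{\Gamma(\beta)}\int_t^b(s-t)^{\beta-1}\varphi(s)\,ds$, ${}_t\mathrm{D}_b^{\alpha}\varphi(t)=-\frac{d}{dt}\,{}_t\mathrm{I}_b^{1-\alpha}\varphi(t)$. State-transition matrices: $\Psi(a,t)=\sum_{k\ge0}A^k\,{}_a\mathrm{J}_t^{k\circ\alpha}g(t)$ with ${}_a\mathrm{J}_t^{0\circ\alpha}g=1$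 and ${}_a\mathrm{J}_t^{k\circ\alpha}g={}_a\mathrm{I}_t^{\alpha}\big(g\cdot{}_a\mathrm{J}_t^{(k-1)\circ\alpha}g\big)$ for $k\ge1$; and, for $a\le\tau<t\le b$, $\Phi(\tau,t)=\sum_{k\ge0}A^k\,{}_\tau\mathrm{I}_t^{k\circ\alpha}g(t)$ with ${}_\tau\mathrm{I}_t^{0\circ\alpha}g(t)=\frac{(t-\tau)^{\alpha-1}}{\Gamma(\alpha)}$ and ${}_\tau\mathrm{I}_t^{k\circ\alpha}g={}_\tau\mathrm{I}_t^{\alpha}\big(g\cdot{}_\tau\mathrm{I}_t^{(k-1)\circ\alpha}g\big)$ for $k\ge1$. For fixed upper endpoint $b$, $t\mapsto\Phi(t,b)$ solves ${}_t\mathrm{D}_b^{\alpha}\Phi(t,b)=Ag(t)\Phi(t,b)$, ${}_t\mathrm{I}_b^{1-\alpha}\Phi(t,b)|_{t=b}=\mathbb{I}$ (identity matrix). The solution of the control system is $y(t)=\Psi(a,t)y_0+\int_a^t\Phi(\tau,t)Bu(\tau)\,d\tau$; it is called controllable if for every $y_b\in\mathbb{R}^d$ there exists a control function $u:[a,b]\to\mathbb{R}^N$ such that the solution satisfies $y(b)=y_b$. The solution of the adjoint system is $z(t)=\Phi(t,b)z_b$; the adjoint system is called observable if there exists $C>0$ such that for every $z_b\in\mathbb{R}^d$ the solution $z$ satisfies $|z_b|^2\le C\int_a^b|(b-t)^{1-\alpha}B^{\mathrm T}z(t)|^2\,dt$. *)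

(* Defs.v *)
From HB Require Import structures.
From mathcomp Require Import all_boot all_order all_algebra.
From mathcomp Require Import all_classical all_reals all_analysis.

Set Implicit Arguments.
Unset Strict Implicit.
Unset Printing Implicit Defensive.

Import Order.TTheory GRing.Theory Num.Theory.
Import numFieldNormedType.Exports.

Local Open Scope classical_set_scope.
Local Open Scope ring_scope.

Section FractionalIntegrals.
Context {R : realType}.
Local Notation mu := (@lebesgue_measure R).

Definition Gamma (x : R) : R :=
  \int[mu]_(s in `]0, +oo[) (s `^ (x - 1) * expR (- s)).

(* All the integrands below are only meant on the open interval of integration:
   [0 `^ (alpha - 1)] is 0 by convention, which affects a null set only. *)
Definition RL_integral (alpha a : R) (phi : R -> R) (t : R) : R :=
  (Gamma alpha)^-1 * \int[mu]_(s in `[a, t]) ((t - s) `^ (alpha - 1) * phi s).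

Fixpoint iterated_integral (alpha a : R) (g phi0 : R -> R) (k : nat) : R -> R :=
  if k is k'.+1 then
    RL_integral alpha a (fun s => g s * iterated_integral alpha a g phi0 k' s)
  else phi0.

Definition J_iter (alpha a : R) (g : R -> R) (k : nat) (t : R) : R :=
  iterated_integral alpha a g (fun=> 1) k t.

Definition I_iter (alpha tau : R) (g : R -> R) (k : nat) (t : R) : R :=
  iterated_integral alpha tau g
    (fun s => (s - tau) `^ (alpha - 1) / Gamma alpha) k t.

End FractionalIntegrals.

(* The norm that the library puts on matrices is the sup norm, hence: *)
Definition euclid_norm {R : realType} {n : nat} (v : 'cV[R]_n) : R :=
  Num.sqrt (\sum_i v i 0 ^+ 2).

Section Systems.
Context {R : realType} {d N : nat}.
Local Notation mu := (@lebesgue_measure R).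
Variables (alpha a b : R) (A : 'M[R]_d) (B : 'M[R]_(d, N)) (g : R -> R).

Definition Psi (t : R) : 'M[R]_d :=
  limn (series (fun k => J_iter alpha a g k t *: A ^+ k)).

Definition Phi (tau t : R) : 'M[R]_d :=
  limn (series (fun k => I_iter alpha tau g k t *: A ^+ k)).

Definition control_integrand (u : R -> 'cV[R]_N) (t tau : R) : 'cV[R]_d :=
  Phi tau t *m B *m u tau.

(* The solution of  C_D_a^alpha y = A g y + B u,  y a = y0,  as given by the
   variation-of-constants formula.  With g merely continuous, y need not be
   absolutely continuous, so the formula is the definition of "the solution". *)
Definition control_solution (y0 : 'cV[R]_d) (u : R -> 'cV[R]_N) (t : R)
    : 'cV[R]_d :=
  Psi t *m y0 +
  \col_i \int[mu]_(tau in `[a, t]) control_integrand u t tau i 0.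

(* The controls for which the solution is defined on the whole of [a, b]. *)
Definition admissible_control (u : R -> 'cV[R]_N) : Prop :=
  (forall j, measurable_fun `[a, b] (fun t => u t j 0)) /\
  (forall t, t \in `[a, b] -> forall i,
     mu.-integrable `[a, t] (fun tau => (control_integrand u t tau i 0)%:E)).

Definition controllable (y0 : 'cV[R]_d) : Prop :=
  forall yb : 'cV[R]_d, exists u : R -> 'cV[R]_N,
    admissible_control u /\ control_solution y0 u b = yb.

(* The solution of  t_D_b^alpha z = A g z,  (t_I_b^(1 - alpha) z)(b) = zb,
   where t_D_b^alpha is the right Riemann-Liouville derivative. *)
Definition adjoint_solution (zb : 'cV[R]_d) (t : R) : 'cV[R]_d :=
  Phi t b *m zb.

(* The right-hand side is an integral of a nonnegative function, taken in the
   extended reals so that it is meaningful without an integrability proof. *)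
Definition observable : Prop :=
  exists C : R, 0 < C /\ forall zb : 'cV[R]_d,
    ((euclid_norm zb ^+ 2)%:E <=
     C%:E * \int[mu]_(t in `[a, b])
       (euclid_norm ((b - t) `^ (1 - alpha) *:
                     (B^T *m adjoint_solution zb t)) ^+ 2)%:E)%E.

End Systems.

(* Main.v *)
(* Put Q(t) = (b - t)^(1 - alpha) B^T Phi(t, b) and let W be the integral over
   [a, b] of Q^T Q.  Since A is symmetric, so is Phi, and both properties turn
   out to be equivalent to the invertibility of W: observability says that the
   quadratic form of W is coercive; if W is invertible then the control
   u(t) = (b - t)^(1 - alpha) Q(t) W^-1 (yb - Psi(a, b) y0) reaches yb; and if
   z <> 0 satisfies z^T W z = 0 then B^T Phi(t, b) z = 0 almost everywhere, so
   that z^T y(b) does not depend on the control.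
   For W to exist, Q has to be measurable and bounded.  Measurability in the
   lower endpoint comes from joint measurability of the iterated integrals in
   both endpoints (Tonelli).  Boundedness comes from a bound of the k-th
   iterated integral by C q^k (t - tau)^(alpha - 1) with q as small as desired,
   proved by induction on k with the weight e^(lam (t - tau)), lam large.  The
   value of Gamma(alpha) only enters as a constant factor. *)

Require Import Defs.
From HB Require Import structures.
From mathcomp Require Import all_boot all_order all_algebra.
From mathcomp Require Import all_classical all_reals all_analysis.
From mathcomp Require Import measurable_realfun.
From mathcomp Require Import ring lra.

Set Implicit Arguments.
Unset Strict Implicit.
Unset Printing Implicit Defensive.

Import Order.TTheory GRing.Theory Num.Theory.
Import numFieldNormedType.Exports.

Local Open Scope classical_set_scope.
Local Open Scope ring_scope.

(** * Singular kernels *)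

(** The offset [n.+3] keeps even the first closed interval nondegenerate, so the fundamental theorem
    of calculus applies to every term of the exhaustion. *)
Lemma itvoo_bigcup_itvcc (R : realType) (x y : R) : x < y ->
  `]x, y[%classic = \bigcup_n [set` `[x + (y - x) / (n.+3)%:R, y - (y - x) / (n.+3)%:R]].
Proof.
move=> xy; apply/seteqP; split => s /=.
- rewrite in_itv/= => /andP[xs sy].
  pose e := Num.min (s - x) (y - s).
  have e0 : 0 < e by rewrite lt_min !subr_gt0 xs.
  have [n hn] : exists n : nat, (y - x) / (n.+3)%:R <= e.
    exists (Num.bound ((y - x) / e)).
    rewrite ler_pdivrMr ?ltr0n// mulrC -ler_pdivrMr//.
    rewrite (le_trans (ltW (archi_boundP _))) ?divr_ge0 ?subr_ge0 1?ltW//.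
    by rewrite ltr_nat !ltnS -addn2 leq_addr.
  move: hn; rewrite le_min => /andP[h1 h2].
  exists n => //=; rewrite in_itv/=.
  by move: h1 h2; set t := _ / _ => h1 h2; apply/andP; split; lra.
- have d0 n : 0 < (y - x) / n.+3%:R by rewrite divr_gt0 ?subr_gt0 ?ltr0n.
  move=> [n _]/=; move: (d0 n); rewrite !in_itv/=; set e := _ / _ => e0 /andP[h1 h2].
  by apply/andP; split; lra.
Qed.

(** A one-sided improper fundamental theorem: [f] may blow up at both ends, and no limit of [F]
    there is assumed. It is applied on the exhausting compact intervals, and monotone convergence
    carries the uniform bound [K] over to the union. *)
Lemma ge0_integral_itvoo_le (R : realType) (f F : R -> R) (x y K : R) :
  x < y -> (forall s, s \in `]x, y[ -> 0 <= f s) ->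
  (forall s, s \in `]x, y[ -> {for s, continuous f}) ->
  (forall s, s \in `]x, y[ -> is_derive s 1 F (f s)) ->
  (forall u v, x < u -> u < v -> v < y -> F v - F u <= K) ->
  (\int[lebesgue_measure]_(s in `]x, y[) (f s)%:E <= K%:E)%E.
Proof.
move=> xy f0 cf dF FK.
have xy0 : 0 <= y - x by rewrite subr_ge0 ltW.
have dn n : 0 < (y - x) / n.+3%:R by rewrite divr_gt0 ?subr_gt0 ?ltr0n.
have sub n : `[x + (y - x) / n.+3%:R, y - (y - x) / n.+3%:R] `<=` `]x, y[.
  move=> s /=; rewrite !in_itv/=; move: (dn n); set e := _ / _ => e0 /andP[h1 h2].
  by apply/andP; split; lra.
have lt n : x + (y - x) / n.+3%:R < y - (y - x) / n.+3%:R.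
  have : (y - x) / n.+3%:R <= (y - x) / 3%:R.
    by rewrite ler_wpM2l// lef_pV2 ?posrE ?ltr0n// ler_nat.
  by move: (dn n); set e := _ / _ => e0 h; lra.
have mf : measurable_fun `]x, y[ f.
  apply: open_continuous_measurable_fun; first exact: interval_open.
  by move=> s; rewrite inE => /cf.
rewrite (itvoo_bigcup_itvcc xy).
have := @ge0_nondecreasing_set_cvg_integral _ (measurableTypeR R) R
  (fun n => [set` `[x + (y - x) / n.+3%:R, y - (y - x) / n.+3%:R]])
  (EFin \o f) (@lebesgue_measure R).
move=> h; apply: (cvge_to_le (h _ _ _ _)) => //=.
- apply/nondecreasing_seqP => n; rewrite subsetEset; apply: subset_itvScc => //.
    by rewrite bnd_simp lerD2l ler_wpM2l// lef_pV2 ?posrE ?ltr0n// ler_nat.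
  rewrite bnd_simp lerD2l lerN2.
  by rewrite ler_wpM2l// lef_pV2 ?posrE ?ltr0n// ler_nat.
- move=> n; apply/measurable_EFinP; apply: measurable_funS mf => //.
- by move=> n s /sub sxy; rewrite lee_fin f0.
- apply: nearW => n.
  have dF' s : s \in `[x + (y - x) / n.+3%:R, y - (y - x) / n.+3%:R] ->
      is_derive s 1 F (f s) by move=> hs; exact: dF (sub n _ hs).
  rewrite (@continuous_FTC2 _ f F)//.
  + by rewrite -EFinB lee_fin; apply: FK => //; rewrite ?ltrDl// gtrDl oppr_lt0.
  + apply: continuous_in_subspaceT => s; rewrite inE => hs; apply: cf; exact: sub hs.
  + split.
    * move=> s hs; have [] := dF' s _ => //; exact: subset_itv_oo_cc.
    * apply: cvg_at_right_filter; apply: differentiable_continuous.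
      apply/derivable1_diffP.
      by have [] := dF' (x + (y - x) / n.+3%:R); rewrite ?in_itv/= ?lexx ?ltW.
    * apply: cvg_at_left_filter; apply: differentiable_continuous.
      apply/derivable1_diffP.
      by have [] := dF' (y - (y - x) / n.+3%:R); rewrite ?in_itv/= ?lexx ?ltW.
  + move=> s /subset_itv_oo_cc hs; rewrite derive1E.
    by have [_ ->] := dF' s hs.
Qed.

Lemma measurable_fun_powRr (d : measure_display) (T : measurableType d) (R : realType) (D : set T)
    (f : T -> R) (p : R) :
  measurable_fun D f -> measurable_fun D (fun x => f x `^ p).
Proof. exact: (@measurableT_comp _ _ _ _ _ _ (@powR R ^~ p)). Qed.

Lemma integral_powR_subl_le (R : realType) (nu x y : R) : 0 < nu -> x <= y ->
  (\int[lebesgue_measure]_(s in `[x, y]) ((s - x) `^ (nu - 1))%:E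
    <= ((y - x) `^ nu / nu)%:E)%E.
Proof.
move=> nu0; rewrite le_eqVlt => /predU1P[->|xy].
  by rewrite set_itv1 integral_set1 lee_fin divr_ge0 ?powR_ge0 ?ltW.
(* The endpoints form a null set; dropping them removes the singularity at [x] that occurs for
   [nu < 1]. *)
rewrite (@integral_itv_bndoo _ x y); last first.
  by apply/measurable_EFinP; apply: measurable_fun_powRr; exact: measurable_funD.
have dsub (s : R) : is_derive s (1 : R) (fun s => s - x) 1.
  by rewrite -[X in is_derive _ _ _ X]subr0; exact: is_deriveB.
have dp (a s : R) : s \in `]x, y[ ->
    is_derive s (1 : R) (fun s => (s - x) `^ a) (a * (s - x) `^ (a - 1)).
  rewrite in_itv/= => /andP[xs _].
  rewrite -[X in is_derive _ _ _ X]mulr1.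
  apply: (@is_derive1_comp _ (fun u => u `^ a) (fun s => s - x)).
  by apply: is_derive1_powR; rewrite subr_gt0.
apply: (@ge0_integral_itvoo_le _ _ (fun s => (s - x) `^ nu / nu)) => //.
- by move=> s _; exact: powR_ge0.
- move=> s hs; apply: differentiable_continuous; apply/derivable1_diffP.
  by have [] := dp (nu - 1) s hs.
- move=> s hs; have := dp nu s hs => h.
  rewrite (_ : (s - x) `^ (nu - 1) = nu^-1 *: (nu * (s - x) `^ (nu - 1))); last first.
    by rewrite scalerA mulVf ?gt_eqF// scale1r.
  rewrite (_ : (fun s => _) = nu^-1 \*: (fun s => (s - x) `^ nu)); last first.
    by apply/funext => z; rewrite /= mulrC.
  exact: is_deriveZ.
- move=> u v xu uv vy; rewrite -mulrBl ler_wpM2r ?invr_ge0 ?(ltW nu0)//.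
  rewrite lerBlDr (@le_trans _ _ ((y - x) `^ nu)) ?lerDl ?powR_ge0//.
  rewrite ge0_ler_powR ?nnegrE ?(ltW nu0) ?subr_gt0 ?ltrD2r//; lra.
Qed.

(** Mirror image of [integral_powR_subl_le]: the singularity sits at [y], and the antiderivative is
    -(y - s)^nu / nu. *)
Lemma integral_powR_subr_le (R : realType) (nu x y : R) : 0 < nu -> x <= y ->
  (\int[lebesgue_measure]_(s in `[x, y]) ((y - s) `^ (nu - 1))%:E
    <= ((y - x) `^ nu / nu)%:E)%E.
Proof.
move=> nu0; rewrite le_eqVlt => /predU1P[->|xy].
  by rewrite set_itv1 integral_set1 lee_fin divr_ge0 ?powR_ge0 ?ltW.
rewrite (@integral_itv_bndoo _ x y); last first.
  by apply/measurable_EFinP; apply: measurable_fun_powRr; exact: measurable_funB.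
have dsub (s : R) : is_derive s (1 : R) (fun s => y - s) (- 1).
  by rewrite -[X in is_derive _ _ _ X]sub0r; exact: is_deriveB.
have dp (a s : R) : s \in `]x, y[ ->
    is_derive s (1 : R) (fun s => (y - s) `^ a) (a * (y - s) `^ (a - 1) * - 1).
  rewrite in_itv/= => /andP[_ sy].
  apply: (@is_derive1_comp _ (fun u => u `^ a) (fun s => y - s)).
  by apply: is_derive1_powR; rewrite subr_gt0.
apply: (@ge0_integral_itvoo_le _ _ (fun s => - (y - s) `^ nu / nu)) => //.
- by move=> s _; exact: powR_ge0.
- move=> s hs; apply: differentiable_continuous; apply/derivable1_diffP.
  by have [] := dp (nu - 1) s hs.
- move=> s hs; have := dp nu s hs => h.
  rewrite (_ : (y - s) `^ (nu - 1) =
      (- nu^-1) *: (nu * (y - s) `^ (nu - 1) * - 1)); last first.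
    by rewrite /GRing.scale/= mulrN1 mulrNN mulrA mulVf ?gt_eqF// mul1r.
  rewrite (_ : (fun s => _) = (- nu^-1) \*: (fun s => (y - s) `^ nu)); last first.
    by apply/funext => z; rewrite /= /GRing.scale/= !mulNr mulrC.
  exact: is_deriveZ.
- move=> u v xu uv vy; rewrite -mulrBl ler_wpM2r ?invr_ge0 ?(ltW nu0)//.
  rewrite opprK (@le_trans _ _ ((y - u) `^ nu)) ?gerDr ?oppr_le0 ?powR_ge0//.
  rewrite ge0_ler_powR ?nnegrE ?(ltW nu0)//; lra.
Qed.

(** Positivity of [u] is essential: a zero base raised to a negative power is 0 by convention. *)
Lemma le0_ler_powR (R : realType) (r u v : R) :
  r <= 0 -> 0 < u -> u <= v -> v `^ r <= u `^ r.
Proof.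
move=> r0 u0 uv; have v0 := lt_le_trans u0 uv.
rewrite -(opprK r) !(powRN _ (- r)) lef_pV2 ?posrE ?powR_gt0//.
by rewrite ge0_ler_powR ?nnegrE ?oppr_ge0 ?(ltW u0) ?(ltW v0).
Qed.

(* Of the two factors, the one whose base is at least half of [y - x] is
   bounded; this replaces the evaluation of the Beta integral. *)
Lemma Beta_kernel_le (R : realType) (m n x y s : R) :
  m <= 1 -> n <= 1 -> x < y -> s \in `[x, y] ->
  (y - s) `^ (m - 1) * (s - x) `^ (n - 1) <=
    ((y - x) / 2) `^ (n - 1) * (y - s) `^ (m - 1) +
    ((y - x) / 2) `^ (m - 1) * (s - x) `^ (n - 1).
Proof.
move=> m1 n1 xy; rewrite in_itv/= => /andP[xs sy].
have [h|h] := leP ((y - x) / 2) (s - x).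
- rewrite mulrC (@le_trans _ _ (((y - x) / 2) `^ (n - 1) * (y - s) `^ (m - 1)))//.
    by rewrite ler_wpM2r ?powR_ge0// le0_ler_powR//; lra.
  by rewrite lerDl mulr_ge0 ?powR_ge0.
- rewrite (@le_trans _ _ (((y - x) / 2) `^ (m - 1) * (s - x) `^ (n - 1)))//.
    by rewrite ler_wpM2r ?powR_ge0// le0_ler_powR//; lra.
  by rewrite lerDr mulr_ge0 ?powR_ge0.
Qed.

(** Obtained by integrating the two terms of [Beta_kernel_le]. What matters later is the exponent m
    + n - 1 of the length, the same as in the exact Beta integral. *)
Lemma integral_Beta_kernel_le (R : realType) (m n x y : R) :
  0 < m -> m <= 1 -> 0 < n -> n <= 1 -> x <= y ->
  (\int[lebesgue_measure]_(s in `[x, y])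
     ((y - s) `^ (m - 1) * (s - x) `^ (n - 1))%:E <=
   ((2 `^ (1 - n) / m + 2 `^ (1 - m) / n) * (y - x) `^ (m + n - 1))%:E)%E.
Proof.
move=> m0 m1 n0 n1; rewrite le_eqVlt => /predU1P[->|xy].
  rewrite set_itv1 integral_set1 lee_fin mulr_ge0 ?powR_ge0//.
  by rewrite addr_ge0// divr_ge0 ?powR_ge0 ?ltW.
have mfl : measurable_fun `[x, y] (fun s : R => (s - x) `^ (n - 1)).
  by apply: measurable_fun_powRr; exact: measurable_funD.
have mfr : measurable_fun `[x, y] (fun s : R => (y - s) `^ (m - 1)).
  by apply: measurable_fun_powRr; exact: measurable_funB.
(* A factor frozen at half the length times the integral of the remaining kernel; both constants of
   the statement have this shape. *)
have powE : forall p q : R, ((y - x) / 2) `^ (p - 1) * ((y - x) `^ q / q) =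
    2 `^ (1 - p) / q * (y - x) `^ (q + p - 1).
  move=> p q; have d0 : 0 < y - x by rewrite subr_gt0.
  rewrite powRM ?invr_ge0 ?(ltW d0)//.
  rewrite -(powR_inv1 (ler0n R 2)) -powRrM mulN1r opprB.
  rewrite -(addrA q) [_ `^ (q + _)]powRD; last by rewrite (gt_eqF d0) implybT.
  by ring.
apply: (@le_trans _ _ (\int[lebesgue_measure]_(s in `[x, y])
   ((((y - x) / 2) `^ (n - 1))%:E * ((y - s) `^ (m - 1))%:E +
    (((y - x) / 2) `^ (m - 1))%:E * ((s - x) `^ (n - 1))%:E))%E).
  apply: ge0_le_integral => //.
  - by move=> s _; rewrite lee_fin mulr_ge0 ?powR_ge0.
  - by apply/measurable_EFinP; exact: measurable_funM.
  - by apply: emeasurable_funD; apply: measurable_funeM; apply/measurable_EFinP.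
  - by move=> s hs; rewrite -!EFinM -EFinD lee_fin Beta_kernel_le.
rewrite ge0_integralD//; last 4 first.
- by move=> s _; rewrite mule_ge0 ?lee_fin ?powR_ge0.
- by apply: measurable_funeM; apply/measurable_EFinP.
- by move=> s _; rewrite mule_ge0 ?lee_fin ?powR_ge0.
- by apply: measurable_funeM; apply/measurable_EFinP.
rewrite !ge0_integralZl//; last 6 first.
- by apply/measurable_EFinP.
- by move=> s _; rewrite lee_fin powR_ge0.
- by rewrite lee_fin powR_ge0.
- by apply/measurable_EFinP.
- by move=> s _; rewrite lee_fin powR_ge0.
- by rewrite lee_fin powR_ge0.
rewrite [in leRHS]mulrDl -powE (addrC m n) -powE EFinD leeD//.
- by rewrite EFinM lee_wpmul2l ?lee_fin ?powR_ge0// integral_powR_subr_le// ltW.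
- by rewrite EFinM lee_wpmul2l ?lee_fin ?powR_ge0// integral_powR_subl_le// ltW.
Qed.

(** Whether u is below or above 1, u^r <= 1 + u <= e^u; the claim is the inverse of this. *)
Lemma expRN_le_powRN (R : realType) (r u : R) : 0 <= r -> r <= 1 -> 0 < u ->
  expR (- u) <= u `^ (- r).
Proof.
move=> r0 r1 u0; rewrite expRN powRN lef_pV2 ?posrE ?expR_gt0 ?powR_gt0//.
apply: le_trans (expR_ge1Dx u); have [u1|u1] := leP u 1.
  rewrite (@le_trans _ _ 1) ?lerDl ?(ltW u0)//.
  have <- : 1 `^ r = 1 :> R by rewrite powR1.
  by rewrite ge0_ler_powR ?nnegrE ?(ltW u0).
by rewrite (@le_trans _ _ u) ?lerDr// ler1_powR// ltW.
Qed.

(* With [u = y - s], the factor [expR (- lam * u)] left over after extracting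
   the weight at [y] is at most [(lam * u) `^ (- (alpha / 2))]: half of the
   integrability margin of the kernel is spent on smallness in [lam]. *)
Lemma weighted_kernel_small (R : realType) (alpha l eps : R) :
  0 < alpha -> alpha < 1 -> 0 < l -> 0 < eps ->
  exists2 lam : R, 0 < lam & forall x y, x <= y -> y - x <= l ->
    (\int[lebesgue_measure]_(s in `[x, y]) ((y - s) `^ (alpha - 1) *
       ((s - x) `^ (alpha - 1) * expR (lam * (s - x))))%:E <=
     (eps * ((y - x) `^ (alpha - 1) * expR (lam * (y - x))))%:E)%E.
Proof.
move=> a0 a1 l0 eps0.
pose m := alpha / 2.
have m0 : 0 < m by rewrite divr_gt0.
have m1 : m <= 1 by rewrite /m; lra.
pose K := 2 `^ (1 - alpha) / m + 2 `^ (1 - m) / alpha.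
have K0 : 0 < K by rewrite addr_gt0// divr_gt0 ?powR_gt0.
(* Solves lam^(-m) l^m K = eps, where l^m will bound the surplus factor (y - x)^m of the Beta-type
   estimate. *)
pose lam := l * (K / eps) `^ m^-1.
have lam0 : 0 < lam by rewrite mulr_gt0// powR_gt0// divr_gt0.
have lamE : lam `^ (- m) * l `^ m * K = eps.
  rewrite /lam powRM ?powR_ge0 ?ltW// -powRrM mulrN mulVf ?gt_eqF// powR_inv1; last first.
    by rewrite divr_ge0 ?ltW.
  rewrite powRN invf_div; field.
  by rewrite !gt_eqF ?powR_gt0.
exists lam => // x y; rewrite le_eqVlt => /predU1P[-> _|xy yxl].
  rewrite set_itv1 integral_set1 lee_fin.
  by rewrite !mulr_ge0 ?powR_ge0 ?expR_ge0 ?(ltW eps0).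
have mfl : measurable_fun `[x, y] (fun s : R => (s - x) `^ (alpha - 1)).
  by apply: measurable_fun_powRr; exact: measurable_funD.
have mfr c : measurable_fun `[x, y] (fun s : R => (y - s) `^ c).
  by apply: measurable_fun_powRr; exact: measurable_funB.
have me : measurable_fun `[x, y] (fun s : R => expR (lam * (s - x))).
  apply: measurableT_comp => //; apply: measurable_funM => //.
  exact: measurable_funD.
pose c := expR (lam * (y - x)) * lam `^ (- m).
have c0 : 0 <= c by rewrite mulr_ge0 ?expR_ge0 ?powR_ge0.
apply: (@le_trans _ _ (\int[lebesgue_measure]_(s in `[x, y])
   (c%:E * ((y - s) `^ (m - 1) * (s - x) `^ (alpha - 1))%:E))%E).
  apply: ge0_le_integral => //.
  - by move=> s _; rewrite lee_fin !mulr_ge0 ?powR_ge0 ?expR_ge0.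
  - apply/measurable_EFinP; apply: measurable_funM; first exact: mfr.
    exact: measurable_funM.
  - by apply: measurable_funeM; apply/measurable_EFinP/measurable_funM => //; exact: mfr.
  - move=> s; rewrite /= in_itv/= => /andP[xs sy]; rewrite -EFinM lee_fin.
    (* At s = y the left side vanishes, a zero base with the nonzero exponent alpha - 1 giving 0;
       the exponent laws below need y - s > 0. *)
    move: sy; rewrite le_eqVlt => /predU1P[->|sy].
      by rewrite subrr powR0 ?mul0r ?mulr_ge0 ?powR_ge0//; rewrite lt_eqF//; lra.
    have ys : 0 < y - s by rewrite subr_gt0.
    rewrite (_ : lam * (s - x) = lam * (y - x) + - (lam * (y - s))); last by ring.
    rewrite expRD /c.
    (* Since alpha = 2m, the exponent m - 1 equals alpha - 1 - m: trading the exponential for a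
       power costs exactly (y - s)^(-m). *)
    have -> : (y - s) `^ (m - 1) = (y - s) `^ (alpha - 1) * (y - s) `^ (- m).
      rewrite -powRD; last by rewrite (gt_eqF ys) implybT.
      by congr (_ `^ _); rewrite /m; lra.
    have /(ler_wpM2l (x := (y - s) `^ (alpha - 1) * (s - x) `^ (alpha - 1) *
        expR (lam * (y - x)))) := expRN_le_powRN (ltW m0) m1 (mulr_gt0 lam0 ys).
    rewrite !mulr_ge0 ?powR_ge0 ?expR_ge0// => /(_ isT) h.
    rewrite powRM ?(ltW lam0) ?(ltW ys)// in h.
    by move: h; congr (_ <= _); ring.
rewrite ge0_integralZl//; last 2 first.
- by apply/measurable_EFinP/measurable_funM => //; exact: mfr.
- by move=> s _; rewrite lee_fin mulr_ge0 ?powR_ge0.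
apply: (@le_trans _ _ (c * (K * (y - x) `^ (m + alpha - 1)))%:E).
  rewrite [leRHS]EFinM; apply: lee_wpmul2l; first by rewrite lee_fin.
  by apply: integral_Beta_kernel_le => //; apply: ltW.
rewrite lee_fin -addrA [_ `^ (m + _)]powRD; last first.
  by apply/implyP => _; rewrite gt_eqF// subr_gt0.
apply: (@le_trans _ _ (c * (K * (l `^ m * (y - x) `^ (alpha - 1))))).
  rewrite ler_wpM2l// ler_wpM2l ?(ltW K0)// ler_wpM2r ?powR_ge0//.
  by rewrite ge0_ler_powR ?nnegrE ?(ltW m0) ?(ltW l0) ?subr_ge0 ?(ltW xy).
by rewrite -lamE /c le_eqVlt; apply/orP; left; apply/eqP; ring.
Qed.

(** * Iterated fractional integrals *)

(** Tonelli handles the positive and the negative part separately. Integrability is not at stake,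
    because subtraction in the extended reals and [fine] are total and measurable. *)
Lemma measurable_Rintegral_param (d : measure_display) (T : measurableType d)
    (R : realType) (h : T * R -> R) : measurable_fun setT h ->
  measurable_fun setT (fun z => \int[lebesgue_measure]_s h (z, s)).
Proof.
move=> mh; apply: (@measurableT_comp _ _ _ _ _ _ fine); first exact: fine_measurable.
under eq_fun do rewrite integralE.
have mE : measurable_fun setT (EFin \o h) by exact/measurable_EFinP.
apply: emeasurable_funB.
- have := @measurable_fun_fubini_tonelli_F _ _ T _ R lebesgue_measure _
    (measurable_funepos mE) (funepos_ge0 _).
  apply: eq_measurable_fun => z _; rewrite /fubini_F.
  by apply: eq_integral => s _; rewrite !funeposE.
- have := @measurable_fun_fubini_tonelli_F _ _ T _ R lebesgue_measure _
    (measurable_funeneg mE) (funeneg_ge0 _).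
  apply: eq_measurable_fun => z _; rewrite /fubini_F.
  by apply: eq_integral => s _; rewrite !funenegE.
Qed.

(** The induction has to carry both endpoints: the variable of integration at level k + 1 is the
    upper endpoint at level k, while the lower endpoint stays a parameter. *)
Lemma measurable_I_iter (R : realType) (alpha : R) (g : R -> R) (k : nat) :
  measurable_fun setT g ->
  measurable_fun setT (fun z : R * R => I_iter alpha z.1 g k z.2).
Proof.
move=> mg; elim: k => [|k ih].
  apply: measurable_funM => //; apply: measurable_fun_powRr.
  exact: measurable_funB.
apply: measurable_funM => //.
(* The moving domain of integration is absorbed into the integrand, as Tonelli needs a fixed one. *)
pose h (w : (R * R) * R) := if (w.1.1 <= w.2) && (w.2 <= w.1.2) then
    (w.1.2 - w.2) `^ (alpha - 1) * (g w.2 * I_iter alpha w.1.1 g k w.2) else 0.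
have mh : measurable_fun setT h.
  have m1 : measurable_fun setT (fun w : (R * R) * R => w.1.1).
    exact: (measurableT_comp measurable_fst measurable_fst).
  have m2 : measurable_fun setT (fun w : (R * R) * R => w.1.2).
    exact: (measurableT_comp measurable_snd measurable_fst).
  have m3 : measurable_fun setT (fun w : (R * R) * R => w.2).
    exact: measurable_snd.
  apply: measurable_fun_ifT => //.
    by apply: measurable_and; exact: measurable_fun_ler.
  apply: measurable_funM.
    by apply: measurable_fun_powRr; exact: measurable_funB.
  apply: measurable_funM; first exact: measurableT_comp.
  exact: (measurableT_comp ih (measurable_fun_pair m1 m3)).
apply: eq_measurable_fun (measurable_Rintegral_param mh) => z _.
rewrite [RHS]Rintegral_mkcond; apply: eq_Rintegral => s _.
by rewrite /h patchE mem_setE in_itv.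
Qed.

(** Allows [g], controlled only on an interval, to be replaced by its extension by zero, which is
    measurable and bounded on the whole line. *)
Lemma eq_iterated_integral (R : realType) (alpha a : R) (g1 g2 phi : R -> R)
    (k : nat) (t : R) : (forall s, s \in `[a, t] -> g1 s = g2 s) ->
  iterated_integral alpha a g1 phi k t = iterated_integral alpha a g2 phi k t.
Proof.
elim: k t => //= k ih t g12; congr (_ * _); apply: eq_Rintegral => s.
rewrite inE => hs; rewrite g12// ih// => r hr; apply: g12.
by move: hs hr; rewrite /= !in_itv/= => /andP[_ st] /andP[-> /le_trans]; exact.
Qed.

(** The bound on [h] is stated in the extended reals so that one inequality yields both the
    finiteness and the estimate. *)
Lemma normr_Rintegral_dominated (d : measure_display) (T : measurableType d)
    (R : realType) (mu : {measure set T -> \bar R}) (D : set T) (f h : T -> R)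
    (K : R) :
  measurable D -> measurable_fun D f -> measurable_fun D h ->
  (forall x, D x -> `|f x| <= h x) -> (\int[mu]_(x in D) (h x)%:E <= K%:E)%E ->
  mu.-integrable D (EFin \o f) /\ `|\int[mu]_(x in D) f x| <= K.
Proof.
move=> mD mf mh fh hK.
have mEf : measurable_fun D (EFin \o f) by exact/measurable_EFinP.
have fK : (\int[mu]_(x in D) `|(EFin \o f) x| <= K%:E)%E.
  apply: le_trans hK; apply: ge0_le_integral => //.
  - exact: measurableT_comp.
  - exact/measurable_EFinP.
have fi : mu.-integrable D (EFin \o f).
  by apply/integrableP; split => //; exact: le_lt_trans fK (ltry _).
split=> //; rewrite -lee_fin EFin_normr_Rintegral//.
exact: le_trans (le_abse_integral _ _ _) fK.
Qed.

(** In the norm weighted by (y - x)^(alpha - 1) e^(lam (y - x)), one step of the iteration is a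
    contraction of factor [q]. The weight [lam] is fixed before [g], [k] and the endpoints, so the
    same one serves at every level of the induction. *)
Lemma I_iter_le (R : realType) (alpha l M q : R) :
  0 < alpha -> alpha < 1 -> 0 < l -> 0 <= M -> 0 < q ->
  exists2 lam : R, 0 < lam & forall (g : R -> R), measurable_fun setT g ->
    (forall s, `|g s| <= M) -> forall k x y, x <= y -> y - x <= l ->
    `|I_iter alpha x g k y| <= `|(Gamma alpha)^-1| * q ^+ k *
      ((y - x) `^ (alpha - 1) * expR (lam * (y - x))).
Proof.
move=> a0 a1 l0 M0 q0; set c := (Gamma alpha)^-1.
have cM0 : 0 < `|c| * M + 1 by rewrite ltr_wpDl ?mulr_ge0.
(* One iteration multiplies the weighted bound by |c| M eps, which is at most q; the added 1 keeps
   the divisor positive when |c| M = 0. *)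
have eps0 : 0 < q / (`|c| * M + 1) by rewrite divr_gt0.
have [lam lam0 Hlam] := weighted_kernel_small a0 a1 l0 eps0.
exists lam => // g mg gM; elim => [|k ih] x y xy yxl.
  rewrite /I_iter/= -/c expr0 mulr1 normrM (ger0_norm (powR_ge0 _ _)) mulrC.
  rewrite ler_wpM2l// ler_peMr ?powR_ge0//.
  by rewrite -expR0 ler_expR mulr_ge0 ?subr_ge0 ?(ltW lam0).
rewrite [I_iter _ _ _ _ _]/(c * _) normrM.
set W := _ `^ _ * _.
(* The induction hypothesis inserted under the integral; what remains is the kernel estimated by
   [weighted_kernel_small]. *)
pose h s := M * (`|c| * q ^+ k) * ((y - s) `^ (alpha - 1) *
  ((s - x) `^ (alpha - 1) * expR (lam * (s - x)))).
have mK : measurable_fun `[x, y] (fun s => (y - s) `^ (alpha - 1) *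
    ((s - x) `^ (alpha - 1) * expR (lam * (s - x)))).
  apply: measurable_funM; last apply: measurable_funM.
  - by apply: measurable_fun_powRr; exact: measurable_funB.
  - by apply: measurable_fun_powRr; exact: measurable_funD.
  - apply: measurableT_comp => //; apply: measurable_funM => //.
    exact: measurable_funD.
have mf : measurable_fun `[x, y]
    (fun s => (y - s) `^ (alpha - 1) * (g s * I_iter alpha x g k s)).
  apply: measurable_funM; last apply: measurable_funM.
  - by apply: measurable_fun_powRr; exact: measurable_funB.
  - exact: measurable_funS mg.
  - apply: (@measurable_funS _ _ _ _ setT) => //.
    exact: (measurable_fun_pair2 x (measurable_I_iter alpha k mg)).
have mh : measurable_fun `[x, y] h by exact: measurable_funM.
have fh s : `[x, y]%classic s ->
    `|(y - s) `^ (alpha - 1) * (g s * I_iter alpha x g k s)| <= h s.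
  rewrite /= in_itv/= => /andP[xs sy].
  rewrite normrM (ger0_norm (powR_ge0 _ _)) /h mulrCA ler_wpM2l ?powR_ge0//.
  rewrite -!mulrA normrM ler_pM// mulrA ih//.
  by rewrite (le_trans _ yxl)// lerD2r.
have hK : (\int[lebesgue_measure]_(s in `[x, y]) (h s)%:E <=
    (M * (`|c| * q ^+ k) * (q / (`|c| * M + 1) * W))%:E)%E.
  rewrite /h; under eq_integral do rewrite EFinM.
  have C0 : 0 <= M * (`|c| * q ^+ k) by rewrite !mulr_ge0 ?exprn_ge0 ?(ltW q0).
  rewrite ge0_integralZl ?lee_fin//; first last.
  - by move=> s _; rewrite lee_fin !mulr_ge0 ?powR_ge0 ?expR_ge0.
  - exact/measurable_EFinP.
  rewrite [leRHS]EFinM; apply: lee_wpmul2l; first by rewrite lee_fin.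
  exact: Hlam.
have [//|_ le_int] := @normr_Rintegral_dominated _ (measurableTypeR R) R lebesgue_measure _
  _ _ _ _ mf mh fh hK.
apply: le_trans (ler_wpM2l (normr_ge0 c) le_int) _.
have -> : `|c| * (M * (`|c| * q ^+ k) * (q / (`|c| * M + 1) * W)) =
    `|c| * q ^+ k.+1 * W * (`|c| * M / (`|c| * M + 1)).
  by rewrite exprS; ring.
apply: ler_piMr; last by rewrite ler_pdivrMr// mul1r lerDl.
by rewrite !mulr_ge0 ?exprn_ge0 ?powR_ge0 ?expR_ge0 ?(ltW q0).
Qed.

(** On lengths up to [l] the exponential weight is at most e^(lam l) and disappears into the
    constant, while [q] stays free to be chosen against the growth of the powers of a matrix. *)
Lemma I_iter_geometric (R : realType) (alpha l M q : R) :
  0 < alpha -> alpha < 1 -> 0 < l -> 0 <= M -> 0 < q ->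
  exists2 C : R, 0 <= C & forall (g : R -> R), measurable_fun setT g ->
    (forall s, `|g s| <= M) -> forall k x y, x <= y -> y - x <= l ->
    `|I_iter alpha x g k y| <= C * q ^+ k * (y - x) `^ (alpha - 1).
Proof.
move=> a0 a1 l0 M0 q0; have [lam lam0 H] := I_iter_le a0 a1 l0 M0 q0.
exists (`|(Gamma alpha)^-1| * expR (lam * l)); first by rewrite mulr_ge0 ?expR_ge0.
move=> g mg gM k x y xy yxl; apply: le_trans (H g mg gM k x y xy yxl) _.
rewrite (_ : _ * expR _ * _ * _ = `|(Gamma alpha)^-1| * q ^+ k *
  ((y - x) `^ (alpha - 1) * expR (lam * l))); last by ring.
apply: ler_wpM2l; first by rewrite mulr_ge0 ?exprn_ge0 ?(ltW q0).
apply: ler_wpM2l; first exact: powR_ge0.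
by rewrite ler_expR ler_wpM2l ?(ltW lam0).
Qed.

(** * The state-transition matrix *)

Lemma cvg_mx_entries (R : realType) (m n : nat) (u : nat -> 'M[R]_(m, n))
    (l : 'M[R]_(m, n)) :
  (forall i j, (fun k => u k i j) @ \oo --> l i j) -> u @ \oo --> l.
Proof.
move=> ul; apply/cvg_ballP => e e0.
have H : \forall k \near \oo, forall ij : 'I_m * 'I_n,
    ball (l ij.1 ij.2) e (u k ij.1 ij.2).
  apply: filter_forall => -[i j] /=.
  by move/cvg_ballP: (ul i j); apply.
by apply: filterS H => k H; split => // i j; exact: (H (i, j)).
Qed.

Lemma series_mx_entry (R : realType) (m n : nat) (u : nat -> 'M[R]_(m, n))
    (i : 'I_m) (j : 'I_n) (k : nat) :
  series u k i j = series (fun k => u k i j) k.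
Proof. by rewrite /series/= summxE. Qed.

(** [limn] is a total function, so an entry can be taken inside it only once the entrywise limits
    are known to exist. *)
Lemma lim_series_mx_entry (R : realType) (m n : nat) (u : nat -> 'M[R]_(m, n)) :
  (forall i j, cvgn (series (fun k => u k i j))) ->
  forall i j, limn (series u) i j = limn (series (fun k => u k i j)).
Proof.
move=> cu i j.
have /cvg_lim -> // : series u @ \oo -->
    \matrix_(i, j) limn (series (fun k => u k i j)).
  apply: cvg_mx_entries => a b; rewrite mxE.
  by under eq_fun do rewrite series_mx_entry; exact: cu.
by rewrite mxE.
Qed.

Lemma series_geometric_le (R : realType) (u : nat -> R) (c : R) :
  (forall k, `|u k| <= c * 2^-1 ^+ k) ->
  cvgn (series u) /\ `|limn (series u)| <= c * 2.
Proof.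
move=> uc; have h1 : `|2^-1 : R| < 1 by rewrite ger0_norm ?invf_lt1 ?ltr1n.
have cg := @cvg_geometric_series R c _ h1.
have cn : cvgn [normed series u].
  apply: (series_le_cvg _ _ uc) => [k|k|]; rewrite ?normr_ge0//.
    exact: le_trans (uc k).
  by apply/cvg_ex; eexists; exact: cg.
split; first exact: normed_cvg.
apply: le_trans (lim_series_norm cn) _.
rewrite (_ : c * 2 = limn (series (geometric c 2^-1))).
  by apply: lim_series_le => //; apply/cvg_ex; eexists; exact: cg.
have /cvg_lim -> // := cg.
rewrite (_ : 1 - 2^-1 = 2^-1 :> R) ?invrK//; lra.
Qed.

(** The sum of all absolute entries dominates every row sum, hence the cost of one more factor. The
    summand 1 keeps the base invertible even for A = 0. *)
Lemma mx_exp_entry_le (R : realType) (n : nat) (A : 'M[R]_n) (k : nat) i j :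
  `|(A ^+ k) i j| <= (1 + \sum_a \sum_b `|A a b|) ^+ k.
Proof.
set rho := 1 + _.
have rho0 : 0 <= rho by rewrite addr_ge0// sumr_ge0// => a _; exact: sumr_ge0.
elim: k i j => [|k ih] i j.
  by rewrite !expr0 mxE; case: (_ == _); rewrite ?normr1 ?normr0.
rewrite exprS mxE exprS (le_trans (ler_norm_sum _ _ _))//.
rewrite (@le_trans _ _ (\sum_b `|A i b| * rho ^+ k))//.
  by apply: ler_sum => b _; rewrite normrM ler_wpM2l.
rewrite -mulr_suml ler_wpM2r ?exprn_ge0// /rho [in leRHS](bigD1 i)//=.
rewrite addrCA lerDl addr_ge0// sumr_ge0// => a _; exact: sumr_ge0.
Qed.

Lemma continuous_itv_bounded (R : realType) (a b : R) (g : R -> R) : a <= b ->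
  {within `[a, b], continuous g} ->
  exists2 M : R, 0 <= M & forall s, s \in `[a, b] -> `|g s| <= M.
Proof.
move=> ab cg; have [c _ gc] := EVT_max ab cg; have [e _ ge] := EVT_min ab cg.
exists (`|g c| + `|g e|); first by rewrite addr_ge0.
move=> s hs; rewrite ler_norml; apply/andP; split.
- rewrite (le_trans _ (ge s hs))// lerNl (le_trans (ler_norm _))// normrN.
  by rewrite lerDr.
- by rewrite (le_trans (gc s hs))// (le_trans (ler_norm _))// lerDl.
Qed.

Lemma measurable_continuous_patch (R : realType) (a b : R) (g : R -> R) :
  {within `[a, b], continuous g} -> measurable_fun setT (g \_ `[a, b]).
Proof.
move=> cg; have mab : measurable (`[a, b] : set R) by [].
apply: (measurable_restrictT g mab).1.
exact: subspace_continuous_measurable_fun mab cg.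
Qed.

Lemma I_iter_patch (R : realType) (alpha a b : R) (g : R -> R) (k : nat) (x y : R) :
  a <= x -> y <= b -> I_iter alpha x g k y = I_iter alpha x (g \_ `[a, b]) k y.
Proof.
move=> ax yb; apply: eq_iterated_integral => s; rewrite in_itv/= => /andP[xs sy].
by rewrite patchE mem_set//= in_itv/= (le_trans ax xs) (le_trans sy yb).
Qed.

(** The constant is uniform in the endpoints and the entries. The series formula serves symmetry and
    measurability, the bound serves integrability. On the diagonal x = y the bound forces [Phi] to
    be 0, by the convention for a zero base. *)
Lemma Phi_entryE_le (R : realType) (d : nat) (alpha a b : R) (A : 'M[R]_d)
    (g : R -> R) :
  0 < alpha -> alpha < 1 -> a < b -> {within `[a, b], continuous g} ->
  exists2 C : R, 0 <= C & forall x y i j, a <= x -> x <= y -> y <= b ->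
    [/\ cvgn (series (fun k => I_iter alpha x g k y * (A ^+ k) i j)),
        Phi alpha A g x y i j =
          limn (series (fun k => I_iter alpha x g k y * (A ^+ k) i j)) &
        `|Phi alpha A g x y i j| <= C * (y - x) `^ (alpha - 1)].
Proof.
move=> a0 a1 ab cg; have [M M0 gM] := continuous_itv_bounded (ltW ab) cg.
pose rho := 1 + \sum_i \sum_j `|A i j|.
have rho0 : 0 < rho.
  by apply: ltr_wpDr => //; apply: sumr_ge0 => i _; exact: sumr_ge0.
have ba0 : 0 < b - a by rewrite subr_gt0.
(* With this ratio the growth rho^k of the powers of [A] is beaten and the terms decay like
   2^(-k). *)
have q0 : 0 < (2 * rho)^-1 by rewrite invr_gt0 mulr_gt0.
have [C C0 H] := I_iter_geometric a0 a1 ba0 M0 q0.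
have mg := measurable_continuous_patch cg.
have gM' s : `|(g \_ `[a, b]) s| <= M.
  rewrite patchE; case: ifPn => [|_]; last by rewrite normr0.
  by rewrite inE => /gM.
exists (C * 2); first by rewrite mulr_ge0.
move=> x y.
have bound i j k : a <= x -> x <= y -> y <= b ->
    `|I_iter alpha x g k y * (A ^+ k) i j| <=
    C * (y - x) `^ (alpha - 1) * 2^-1 ^+ k.
  move=> ax xy yb; rewrite normrM (I_iter_patch _ _ _ ax yb).
  have /(ler_pM (normr_ge0 _) (normr_ge0 _)) : `|I_iter alpha x (g \_ `[a, b]) k y| <=
      C * (2 * rho)^-1 ^+ k * (y - x) `^ (alpha - 1).
    by apply: H => //; lra.
  move=> /(_ _ _ _ (mx_exp_entry_le A k i j)) /le_trans; apply.
  have <- : (2 * rho)^-1 ^+ k * rho ^+ k = 2^-1 ^+ k.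
    by rewrite -exprMn invfM -mulrA mulVf ?mulr1// gt_eqF.
  by rewrite le_eqVlt -/rho; apply/orP; left; apply/eqP; ring.
have cvgE i j : a <= x -> x <= y -> y <= b ->
    cvgn (series (fun k => (I_iter alpha x g k y *: A ^+ k) i j)).
  move=> ax xy yb; under eq_fun do rewrite mxE.
  by have [] := series_geometric_le (fun k => bound i j k ax xy yb).
move=> i j ax xy yb.
have [cv le_lim] := series_geometric_le (fun k => bound i j k ax xy yb).
have E : Phi alpha A g x y i j =
    limn (series (fun k => I_iter alpha x g k y * (A ^+ k) i j)).
  rewrite /Phi lim_series_mx_entry => [|i' j']; last exact: cvgE.
  by congr (limn (series _)); apply/funext => k; rewrite mxE.
by split => //; rewrite E mulrAC.
Qed.

Lemma mx_exp_sym (R : realType) (d : nat) (A : 'M[R]_d) (k : nat) :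
  A^T = A -> (A ^+ k)^T = A ^+ k.
Proof.
move=> As; elim: k => [|k ih]; first by rewrite expr0 trmx1.
by rewrite {1}exprS exprSr trmx_mul ih As.
Qed.

(** Every term of the series is a scalar times a power of the symmetric matrix [A]. *)
Lemma Phi_sym (R : realType) (d : nat) (alpha a b : R) (A : 'M[R]_d)
    (g : R -> R) (x y : R) :
  0 < alpha -> alpha < 1 -> a < b -> {within `[a, b], continuous g} ->
  A^T = A -> a <= x -> x <= y -> y <= b ->
  (Phi alpha A g x y)^T = Phi alpha A g x y.
Proof.
move=> a0 a1 ab cg As ax xy yb.
have [C _ H] := Phi_entryE_le A a0 a1 ab cg.
apply/matrixP => i j; rewrite mxE.
have [_ -> _] := H x y j i ax xy yb; have [_ -> _] := H x y i j ax xy yb.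
congr (limn (series _)); apply/funext => k; congr (_ * _).
by rewrite -[in RHS](mx_exp_sym k As) mxE.
Qed.

(** A pointwise limit of partial sums, each measurable as a section, at fixed upper endpoint, of a
    jointly measurable function. *)
Lemma measurable_Phi_entry (R : realType) (d : nat) (alpha a b : R)
    (A : 'M[R]_d) (g : R -> R) (t : R) i j :
  0 < alpha -> alpha < 1 -> a < b -> {within `[a, b], continuous g} ->
  t <= b -> measurable_fun `[a, t] (fun x => Phi alpha A g x t i j).
Proof.
move=> a0 a1 ab cg tb.
have [C _ H] := Phi_entryE_le A a0 a1 ab cg.
have mg := measurable_continuous_patch cg.
apply: (@measurable_fun_cvg _ _ _ _
    (fun n x => series (fun k => I_iter alpha x g k t * (A ^+ k) i j) n)).
- move=> n; apply: measurable_sum => k; apply: measurable_funM => //.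
  apply: (@eq_measurable_fun _ _ _ _ _ (fun x => I_iter alpha x (g \_ `[a, b]) k t)).
    by move=> x; rewrite inE/= in_itv/= => /andP[ax _]; rewrite -I_iter_patch.
  apply: (@measurable_funS _ _ _ _ setT) => //.
  exact: (measurable_fun_pair1 t (measurable_I_iter alpha k mg)).
- move=> x; rewrite /= in_itv/= => /andP[ax xt].
  by have [cv -> _] := H x t i j ax xt tb.
Qed.

(** * Integrals of matrices and quadratic forms *)

Definition mx_integrable (d : measure_display) (T : measurableType d)
    (R : realType) (mu : {measure set T -> \bar R}) (m n : nat) (D : set T)
    (M : T -> 'M[R]_(m, n)) : Prop :=
  forall i j, mu.-integrable D (EFin \o (fun t => M t i j)).

Definition mx_Rintegral (d : measure_display) (T : measurableType d)
    (R : realType) (mu : {measure set T -> \bar R}) (m n : nat) (D : set T)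
    (M : T -> 'M[R]_(m, n)) : 'M[R]_(m, n) :=
  \matrix_(i, j) \int[mu]_(t in D) M t i j.

(** Each entry of a product with a constant matrix is such a combination; this is what lets constant
    matrices pass through entrywise integrals. *)
Lemma integrable_lincomb (d : measure_display) (T : measurableType d) (R : realType)
    (mu : {measure set T -> \bar R}) (n : nat) (D : set T) (c : 'I_n -> R)
    (f : 'I_n -> T -> R) : measurable D ->
  (forall i, mu.-integrable D (EFin \o f i)) ->
  mu.-integrable D (EFin \o (fun t => \sum_i c i * f i t)).
Proof.
move=> mD fi.
have -> : EFin \o (fun t => \sum_i c i * f i t) =
    (fun t => (\sum_i (c i)%:E * (EFin \o f i) t)%E).
  by apply/funext => t; rewrite /= -sumEFin.
by apply: integrable_sum => // i _; exact: integrableZl.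
Qed.

Lemma Rintegral_lincomb (d : measure_display) (T : measurableType d) (R : realType)
    (mu : {measure set T -> \bar R}) (n : nat) (D : set T) (c : 'I_n -> R)
    (f : 'I_n -> T -> R) : measurable D ->
  (forall i, mu.-integrable D (EFin \o f i)) ->
  \int[mu]_(t in D) (\sum_i c i * f i t) =
  \sum_i c i * \int[mu]_(t in D) f i t.
Proof.
move=> mD fi.
have icf i := integrableZl mD (c i) (fi i).
have E : (\int[mu]_(t in D) (\sum_i c i * f i t)%:E =
    (\sum_i c i * \int[mu]_(t in D) f i t)%:E)%E.
  transitivity (\int[mu]_(t in D)
      (\sum_i ((c i)%:E * (EFin \o f i) t)))%E.
    by apply: eq_integral => t _; rewrite -sumEFin.
  rewrite (integral_sum mD icf) -sumEFin; apply: eq_bigr => i _.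
  by rewrite (integralZl mD (fi i)) EFinM /Rintegral (fineK (integrable_fin_num mD (fi i))).
by rewrite {1}/Rintegral E.
Qed.

Lemma mx_integrable_mull (d : measure_display) (T : measurableType d)
    (R : realType) (mu : {measure set T -> \bar R}) (m n p : nat) (D : set T)
    (P : 'M[R]_(p, m)) (M : T -> 'M[R]_(m, n)) : measurable D ->
  mx_integrable mu D M -> mx_integrable mu D (fun t => P *m M t).
Proof.
move=> mD iM i j.
have := integrable_lincomb (fun k => P i k) mD (fun k => iM k j).
by apply: eq_integrable => // t _; rewrite /= mxE.
Qed.

Lemma mx_integrable_mulr (d : measure_display) (T : measurableType d)
    (R : realType) (mu : {measure set T -> \bar R}) (m n p : nat) (D : set T)
    (P : 'M[R]_(n, p)) (M : T -> 'M[R]_(m, n)) : measurable D ->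
  mx_integrable mu D M -> mx_integrable mu D (fun t => M t *m P).
Proof.
move=> mD iM i j.
have := integrable_lincomb (fun k => P k j) mD (fun k => iM i k).
apply: eq_integrable => // t _; rewrite /= mxE.
by congr (_%:E); apply: eq_bigr => k _; rewrite mulrC.
Qed.

Lemma mx_Rintegral_mull (d : measure_display) (T : measurableType d)
    (R : realType) (mu : {measure set T -> \bar R}) (m n p : nat) (D : set T)
    (P : 'M[R]_(p, m)) (M : T -> 'M[R]_(m, n)) : measurable D ->
  mx_integrable mu D M ->
  mx_Rintegral mu D (fun t => P *m M t) = P *m mx_Rintegral mu D M.
Proof.
move=> mD iM; apply/matrixP => i j; rewrite !mxE.
have := Rintegral_lincomb (fun k => P i k) mD (fun k => iM k j) => E.
under eq_Rintegral do rewrite mxE.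
by rewrite E; apply: eq_bigr => k _; rewrite mxE.
Qed.

Lemma mx_Rintegral_mulr (d : measure_display) (T : measurableType d)
    (R : realType) (mu : {measure set T -> \bar R}) (m n p : nat) (D : set T)
    (P : 'M[R]_(n, p)) (M : T -> 'M[R]_(m, n)) : measurable D ->
  mx_integrable mu D M ->
  mx_Rintegral mu D (fun t => M t *m P) = mx_Rintegral mu D M *m P.
Proof.
move=> mD iM; apply/matrixP => i j; rewrite !mxE.
have := Rintegral_lincomb (fun k => P k j) mD (fun k => iM i k) => E.
under eq_Rintegral => t _.
  rewrite mxE; under eq_bigr do rewrite mulrC.
  over.
by rewrite E; apply: eq_bigr => k _; rewrite mxE mulrC.
Qed.

Lemma eq_mx_Rintegral (d : measure_display) (T : measurableType d)
    (R : realType) (mu : {measure set T -> \bar R}) (m n : nat) (D : set T)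
    (M M' : T -> 'M[R]_(m, n)) : (forall t, D t -> M t = M' t) ->
  mx_Rintegral mu D M = mx_Rintegral mu D M'.
Proof.
move=> MM'; apply/matrixP => i j; rewrite !mxE; apply: eq_Rintegral => t.
by rewrite inE => /MM' ->.
Qed.

(** * Euclidean norm and quadratic forms *)

Lemma euclid_norm_sqr (R : realType) (n : nat) (v : 'cV[R]_n) :
  euclid_norm v ^+ 2 = (v^T *m v) 0 0.
Proof.
rewrite /euclid_norm sqr_sqrtr; last by apply: sumr_ge0 => i _; exact: sqr_ge0.
by rewrite mxE; apply: eq_bigr => i _; rewrite mxE expr2.
Qed.

Lemma euclid_norm_sqr_eq0 (R : realType) (n : nat) (v : 'cV[R]_n) :
  euclid_norm v ^+ 2 <= 0 -> v = 0.
Proof.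
rewrite euclid_norm_sqr mxE => h; apply/matrixP => i j; rewrite (ord1 j) mxE.
have sq k : 0 <= v^T 0 k * v k 0 by rewrite mxE -expr2 sqr_ge0.
have /eqP : \sum_k v^T 0 k * v k 0 = 0.
  by apply/eqP; rewrite eq_le h sumr_ge0.
rewrite psumr_eq0// => /allP/(_ i); rewrite mem_index_enum => /(_ isT).
by rewrite mxE -expr2 sqrf_eq0 => /eqP.
Qed.

(** Each product satisfies 2 |x_i| |x_j| <= x_i^2 + x_j^2 <= 2 |x|^2, so the absolute entries of [V]
    add up to a valid, if crude, constant. *)
Lemma quad_form_le (R : realType) (n : nat) (V : 'M[R]_n) (x : 'cV[R]_n) :
  (x^T *m V *m x) 0 0 <= (\sum_i \sum_j `|V i j|) * euclid_norm x ^+ 2.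
Proof.
have xi i : x i 0 ^+ 2 <= euclid_norm x ^+ 2.
  rewrite euclid_norm_sqr mxE (bigD1 i)//= mxE -expr2 lerDl sumr_ge0// => k _.
  by rewrite mxE -expr2 sqr_ge0.
rewrite -mulmxA mxE mulr_suml; apply: ler_sum => i _.
rewrite !mxE mulr_sumr mulr_suml; apply: ler_sum => j _.
rewrite (le_trans (ler_norm _))// !normrM mulrCA ler_wpM2l//.
have := xi i; have := xi j; rewrite -(real_normK (num_real (x j 0))).
rewrite -(real_normK (num_real (x i 0))).
by have := sqr_ge0 (`|x i 0| - `|x j 0|); rewrite sqrrB; lra.
Qed.

(* Expand the form at [x - y / K] with [W y = x]. *)
Lemma psd_unitmx_coercive (R : realType) (n : nat) (W : 'M[R]_n) :
  W^T = W -> (forall x : 'cV[R]_n, 0 <= (x^T *m W *m x) 0 0) -> W \in unitmx ->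
  exists2 K : R, 0 < K &
    forall x : 'cV[R]_n, euclid_norm x ^+ 2 <= K * (x^T *m W *m x) 0 0.
Proof.
move=> Wsym Wpsd Wunit; pose V := invmx W.
have Vsym : V^T = V by rewrite /V trmx_inv Wsym.
pose K := 1 + \sum_i \sum_j `|V i j|.
have K1 : 1 <= K by rewrite lerDl sumr_ge0// => i _; exact: sumr_ge0.
have K0 : 0 < K by rewrite (lt_le_trans _ K1).
exists K => // x.
have xVx : (x^T *m V *m x) 0 0 <= K * euclid_norm x ^+ 2.
  rewrite (le_trans (quad_form_le _ _))// ler_wpM2r ?sqr_ge0//.
  by rewrite lerDr.
pose y := V *m x.
have Wy : W *m y = x by rewrite mulmxA mulmxV// mul1mx.
have yW : y^T *m W = x^T by rewrite trmx_mul Vsym -mulmxA mulVmx// mulmx1.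
have yx : y^T *m x = x^T *m V *m x by rewrite trmx_mul Vsym.
have := Wpsd (x - K^-1 *: y).
have -> : (x - K^-1 *: y)^T = x^T - K^-1 *: y^T by rewrite raddfB /= linearZ.
rewrite mulmxBl -scalemxAl yW mulmxBr !mulmxBl -!scalemxAl -!scalemxAr.
rewrite -(mulmxA x^T W y) Wy.
have -> : x^T *m y = x^T *m V *m x by rewrite mulmxA.
move: xVx; rewrite euclid_norm_sqr.
set e := x^T *m x; set q := x^T *m W *m x; set v := x^T *m V *m x.
clearbody e q v; rewrite !mxE => ve h.
(* The expansion reads 0 <= q - 2 e / K + v / K^2. As v <= K e, the last term is at most e / K,
   whence e / K <= q. *)
have Kv : K^-1 * v 0 0 <= e 0 0 by rewrite ler_pdivrMl.
rewrite -ler_pdivrMl//.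
have := ler_wpM2l (ltW (_ : 0 < K^-1)) Kv; rewrite invr_gt0 K0 => /(_ isT).
lra.
Qed.

(** * The Gramian *)

(** The weight has the order that compensates the blow-up (b - t)^(alpha - 1) of [Phi] at t = b. *)
Definition weighted_observation (R : realType) (d N : nat) (alpha b : R)
    (A : 'M[R]_d) (B : 'M[R]_(d, N)) (g : R -> R) (t : R) : 'M[R]_(N, d) :=
  (b - t) `^ (1 - alpha) *: (B^T *m Phi alpha A g t b).

Definition gramian (R : realType) (d N : nat) (alpha a b : R)
    (A : 'M[R]_d) (B : 'M[R]_(d, N)) (g : R -> R) : 'M[R]_d :=
  mx_Rintegral lebesgue_measure `[a, b] (fun t =>
    (weighted_observation alpha b A B g t)^T *m weighted_observation alpha b A B g t).

Lemma mulmx_entry_le (R : realType) (m n p : nat) (P : 'M[R]_(m, n))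
    (M : 'M[R]_(n, p)) (c : R) i j : (forall k, `|M k j| <= c) ->
  `|(P *m M) i j| <= (\sum_k `|P i k|) * c.
Proof.
move=> Mc; rewrite mxE (le_trans (ler_norm_sum _ _ _))// mulr_suml.
by apply: ler_sum => k _; rewrite normrM ler_wpM2l.
Qed.

Lemma measurable_mulmx_entry (R : realType) (m n p : nat) (D : set R)
    (P : R -> 'M[R]_(m, n)) (M : R -> 'M[R]_(n, p)) i j :
  (forall k, measurable_fun D (fun t => P t i k)) ->
  (forall k, measurable_fun D (fun t => M t k j)) ->
  measurable_fun D (fun t => (P t *m M t) i j).
Proof.
move=> mP mM; under eq_fun do rewrite mxE.
by apply: measurable_sum => k; exact: measurable_funM.
Qed.

Lemma weighted_observation_bounded (R : realType) (d N : nat) (alpha a b : R)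
    (A : 'M[R]_d) (B : 'M[R]_(d, N)) (g : R -> R) :
  0 < alpha -> alpha < 1 -> a < b -> {within `[a, b], continuous g} ->
  exists2 K : R, 0 <= K & forall t : R, t \in `[a, b] -> forall i j,
    `|weighted_observation alpha b A B g t i j| <= K.
Proof.
move=> a0 a1 ab cg; have [C C0 H] := Phi_entryE_le A a0 a1 ab cg.
exists ((\sum_i \sum_k `|B^T i k|) * C).
  by rewrite mulr_ge0// sumr_ge0// => i _; exact: sumr_ge0.
move=> t; rewrite in_itv/= => /andP[at0 tb] i j.
rewrite /weighted_observation scalemxAr (le_trans (@mulmx_entry_le _ _ _ _ _ _ C _ _ _))//.
  move=> k; have [_ _] := H t b k j at0 tb (lexx b).
  rewrite mxE normrM (ger0_norm (powR_ge0 _ _)).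
  move=> /(ler_wpM2l (powR_ge0 (b - t) (1 - alpha))) /le_trans; apply.
  (* For t < b the two powers multiply to 1; at t = b the weight is 0, because 1 - alpha is
     nonzero. *)
  move: tb; rewrite le_eqVlt => /predU1P[->|tb].
    by rewrite subrr powR0 ?mul0r// subr_eq0 gt_eqF.
  rewrite mulrCA -powRD; last first.
    by apply/implyP => _; rewrite subr_eq0 gt_eqF.
  by rewrite addrA subrK subrr powRr0 mulr1.
rewrite ler_wpM2r// (bigD1 i)//= lerDl sumr_ge0// => k _; exact: sumr_ge0.
Qed.

Lemma measurable_weighted_observation (R : realType) (d N : nat) (alpha a b : R)
    (A : 'M[R]_d) (B : 'M[R]_(d, N)) (g : R -> R) i j :
  0 < alpha -> alpha < 1 -> a < b -> {within `[a, b], continuous g} ->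
  measurable_fun `[a, b] (fun t => weighted_observation alpha b A B g t i j).
Proof.
move=> a0 a1 ab cg.
rewrite (_ : (fun t => _) = (fun t => (b - t) `^ (1 - alpha) *
  (B^T *m Phi alpha A g t b) i j)); last by apply/funext => t; rewrite mxE.
apply: measurable_funM.
  by apply: measurable_fun_powRr; exact: measurable_funB.
by apply: measurable_mulmx_entry => // k; exact: (measurable_Phi_entry A k j a0 a1 ab cg).
Qed.

Lemma gramian_integrable (R : realType) (d N : nat) (alpha a b : R)
    (A : 'M[R]_d) (B : 'M[R]_(d, N)) (g : R -> R) :
  0 < alpha -> alpha < 1 -> a < b -> {within `[a, b], continuous g} ->
  mx_integrable lebesgue_measure `[a, b] (fun t =>
    (weighted_observation alpha b A B g t)^T *m weighted_observation alpha b A B g t).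
Proof.
move=> a0 a1 ab cg i j.
have [K K0 QK] := weighted_observation_bounded A B a0 a1 ab cg.
have mQ k l := measurable_weighted_observation A B k l a0 a1 ab cg.
apply: measurable_bounded_integrable => //.
- by rewrite /= lebesgue_measure_itv/= lte_fin ab -EFinD ltry.
- apply: measurable_mulmx_entry => // k.
  rewrite (_ : (fun t => _) = (fun t => weighted_observation alpha b A B g t k i)).
    exact: mQ.
  by apply/funext => t; rewrite mxE.
- exists (\sum_(k < N) K * K); split; first exact: num_real.
  move=> x Kx t /= tab; apply: le_trans (ltW Kx).
  rewrite mxE (le_trans (ler_norm_sum _ _ _))//; apply: ler_sum => k _.
  by rewrite mxE normrM ler_pM//; exact: QK.
Qed.

(** Links the extended-real integral in the definition of observability to the real Gramian;
    integrability guarantees that passing through [fine] loses nothing. *)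
Lemma gramian_form (R : realType) (d N : nat) (alpha a b : R)
    (A : 'M[R]_d) (B : 'M[R]_(d, N)) (g : R -> R) (z : 'cV[R]_d) :
  0 < alpha -> alpha < 1 -> a < b -> {within `[a, b], continuous g} ->
  (\int[lebesgue_measure]_(t in `[a, b])
    (euclid_norm (weighted_observation alpha b A B g t *m z) ^+ 2)%:E =
   ((z^T *m gramian alpha a b A B g *m z) 0 0)%:E)%E.
Proof.
move=> a0 a1 ab cg.
have iG := gramian_integrable A B a0 a1 ab cg.
have mab : measurable (`[a, b]%classic : set (measurableTypeR R)) by [].
have izG := mx_integrable_mull z^T mab iG.
have izGz := mx_integrable_mulr z mab izG.
rewrite /gramian -mx_Rintegral_mull// -mx_Rintegral_mulr// mxE /Rintegral.
rewrite (fineK (integrable_fin_num mab (izGz 0 0))).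
apply: eq_integral => t _; rewrite euclid_norm_sqr trmx_mul /=.
by rewrite !mulmxA.
Qed.

Lemma gramian_sym (R : realType) (d N : nat) (alpha a b : R)
    (A : 'M[R]_d) (B : 'M[R]_(d, N)) (g : R -> R) :
  (gramian alpha a b A B g)^T = gramian alpha a b A B g.
Proof.
apply/matrixP => i j; rewrite !mxE; apply: eq_Rintegral => t _.
by rewrite !mxE; apply: eq_bigr => k _; rewrite !mxE mulrC.
Qed.

Lemma gramian_psd (R : realType) (d N : nat) (alpha a b : R)
    (A : 'M[R]_d) (B : 'M[R]_(d, N)) (g : R -> R) (z : 'cV[R]_d) :
  0 < alpha -> alpha < 1 -> a < b -> {within `[a, b], continuous g} ->
  0 <= (z^T *m gramian alpha a b A B g *m z) 0 0.
Proof.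
move=> a0 a1 ab cg; rewrite -lee_fin -gramian_form//.
by apply: integral_ge0 => t _; rewrite lee_fin sqr_ge0.
Qed.

(** * Observability and the kernel of the Gramian *)

(** A nonzero kernel vector of the Gramian, taken as final datum, would violate the inequality;
    conversely, the coercivity constant of an invertible Gramian serves as C. *)
Lemma observableP (R : realType) (d N : nat) (alpha a b : R)
    (A : 'M[R]_d) (B : 'M[R]_(d, N)) (g : R -> R) :
  0 < alpha -> alpha < 1 -> a < b -> {within `[a, b], continuous g} ->
  observable alpha a b A B g <-> gramian alpha a b A B g \in unitmx.
Proof.
move=> a0 a1 ab cg; set W := gramian _ _ _ _ _ _.
have obsE (zb : 'cV[R]_d) : (\int[lebesgue_measure]_(t in `[a, b])
    (euclid_norm ((b - t) `^ (1 - alpha) *: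
       (B^T *m adjoint_solution alpha b A g zb t)) ^+ 2)%:E =
    ((zb^T *m W *m zb) 0 0)%:E)%E.
  rewrite -gramian_form//; apply: eq_integral => t _.
  by rewrite /weighted_observation /adjoint_solution -scalemxAl mulmxA.
split=> [[C [C0 H]]|Wunit].
- rewrite unitmxE unitfE; apply/det0P => -[v v0 vW].
  have := H v^T; rewrite obsE trmxK vW mul0mx mxE mule0 lee_fin.
  by move=> /euclid_norm_sqr_eq0 /(congr1 trmx); rewrite trmxK trmx0; apply/eqP.
- have Wsym : W^T = W by exact: gramian_sym.
  have Wpsd (z : 'cV[R]_d) : 0 <= (z^T *m W *m z) 0 0 by exact: (gramian_psd A B z a0 a1 ab cg).
  have [K K0 HK] := psd_unitmx_coercive Wsym Wpsd Wunit.
  by exists K; split => // zb; rewrite obsE -EFinM lee_fin.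
Qed.

(** A nonnegative function with zero integral vanishes almost everywhere, which is enough inside
    integrals against a control. *)
Lemma gramian_kernel (R : realType) (d N : nat) (alpha a b : R)
    (A : 'M[R]_d) (B : 'M[R]_(d, N)) (g : R -> R) (z : 'cV[R]_d) :
  0 < alpha -> alpha < 1 -> a < b -> {within `[a, b], continuous g} ->
  (z^T *m gramian alpha a b A B g *m z) 0 0 = 0 ->
  {ae lebesgue_measure, forall t, `[a, b]%classic t ->
    weighted_observation alpha b A B g t *m z = 0}.
Proof.
move=> a0 a1 ab cg zWz.
have mab : measurable (`[a, b]%classic : set (measurableTypeR R)) by [].
have izGz := mx_integrable_mulr z mab
  (mx_integrable_mull z^T mab (gramian_integrable A B a0 a1 ab cg)).
have E : EFin \o (fun t => (z^T *m ((weighted_observation alpha b A B g t)^T *m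
      weighted_observation alpha b A B g t) *m z) 0 0) =
    (fun t => (euclid_norm (weighted_observation alpha b A B g t *m z) ^+ 2)%:E).
  by apply/funext => t; rewrite /= euclid_norm_sqr trmx_mul !mulmxA.
have mf := measurable_int _ (izGz 0 0); rewrite E in mf.
have := gramian_form A B z a0 a1 ab cg; rewrite zWz => int0.
have /(ae_eq_integral_abs lebesgue_measure mab mf) : (\int[lebesgue_measure]_(t in `[a, b])
    `|(euclid_norm (weighted_observation alpha b A B g t *m z) ^+ 2)%:E| = 0)%E.
  by rewrite -[RHS]int0; apply: eq_integral => t _; rewrite /= ger0_norm// sqr_ge0.
apply: filterS => t /[apply] /= -[h].
by apply: euclid_norm_sqr_eq0; rewrite h.
Qed.

(** Removes the weight and transposes, so that the kernel condition applies to the integrand of the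
    control system; this is where the symmetry of [Phi] enters. *)
Lemma weighted_observation_ker (R : realType) (d N : nat) (alpha a b t : R)
    (A : 'M[R]_d) (B : 'M[R]_(d, N)) (g : R -> R) (z : 'cV[R]_d) :
  0 < alpha -> alpha < 1 -> a < b -> {within `[a, b], continuous g} ->
  A^T = A -> t \in `[a, b] -> weighted_observation alpha b A B g t *m z = 0 ->
  z^T *m (Phi alpha A g t b *m B) = 0.
Proof.
move=> a0 a1 ab cg As; rewrite in_itv/= => /andP[at0 tb].
have [C C0 H] := Phi_entryE_le A a0 a1 ab cg.
have := tb; rewrite le_eqVlt => /predU1P[tE _|tltb].
  (* At t = b the weight is 0 and cannot be cancelled, but [Phi] itself vanishes there by the
     diagonal case of its bound. *)
  have -> : Phi alpha A g t b = 0.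
    apply/matrixP => i j; have [_ _] := H t b i j at0 tb (lexx b).
    rewrite tE subrr powR0 ?mulr0 ?normr_le0 ?mxE; first by move=> /eqP.
    by rewrite subr_eq0 lt_eqF.
  by rewrite mul0mx mulmx0.
rewrite /weighted_observation -scalemxAl => /eqP; rewrite scaler_eq0 powR_eq0.
rewrite subr_eq0 (gt_eqF tltb)/= => /eqP /(congr1 trmx).
by rewrite !trmx_mul trmxK (Phi_sym a0 a1 ab cg As at0 tb (lexx b)) trmx0.
Qed.

(** * Controllability and the Gramian *)

Lemma control_solutionE (R : realType) (d N : nat) (alpha a t : R)
    (A : 'M[R]_d) (B : 'M[R]_(d, N)) (g : R -> R) (y0 : 'cV[R]_d)
    (u : R -> 'cV[R]_N) :
  control_solution alpha a A B g y0 u t = Psi alpha a A g t *m y0 +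
    mx_Rintegral lebesgue_measure `[a, t] (control_integrand alpha A B g u t).
Proof.
by congr (_ + _); apply/matrixP => i j; rewrite !mxE (ord1 j).
Qed.

(** A row vector v with v W = 0 annihilates everything a control can contribute. Steering to the
    free state displaced by v^T makes that contribution equal to v^T, so v v^T = 0. *)
Lemma controllable_gramian (R : realType) (d N : nat) (alpha a b : R)
    (A : 'M[R]_d) (B : 'M[R]_(d, N)) (g : R -> R) (y0 : 'cV[R]_d) :
  0 < alpha -> alpha < 1 -> a < b -> {within `[a, b], continuous g} ->
  A^T = A -> controllable alpha a b A B g y0 ->
  gramian alpha a b A B g \in unitmx.
Proof.
move=> a0 a1 ab cg As ctrl; rewrite unitmxE unitfE; apply/det0P => -[v v0 vW].
have [u [[_ iu] ub]] := ctrl (Psi alpha a A g b *m y0 + v^T).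
have mab : measurable (`[a, b]%classic : set (measurableTypeR R)) by [].
have iu' : mx_integrable lebesgue_measure `[a, b] (control_integrand alpha A B g u b).
  by move=> i j; rewrite (ord1 j); apply: iu; rewrite in_itv/= lexx ltW.
move: ub; rewrite control_solutionE => /addrI ub.
have ker : {ae lebesgue_measure, forall t, `[a, b]%classic t ->
    weighted_observation alpha b A B g t *m v^T = 0}.
  by apply: gramian_kernel => //; rewrite trmxK vW mul0mx mxE.
have ivu := mx_integrable_mull v mab iu'.
have vv : v *m v^T = 0.
  rewrite -ub -mx_Rintegral_mull//; apply/matrixP => i j.
  rewrite !mxE /Rintegral.
  rewrite (@ae_eq_integral _ _ _ lebesgue_measure _ (cst 0)) ?integral0//.
    exact: measurable_int (ivu i j).
  apply: (@filterS _ _ (ae_filter_ringOfSetsType (@lebesgue_measure R)) _ _ _ ker).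
  move=> t h tab /=.
  have := weighted_observation_ker a0 a1 ab cg As tab (h tab).
  by rewrite trmxK => vPB; rewrite /control_integrand mulmxA vPB mul0mx mxE.
move/eqP: v0; apply.
have /euclid_norm_sqr_eq0 /(congr1 trmx) : euclid_norm v^T ^+ 2 <= 0.
  by rewrite euclid_norm_sqr trmxK vv mxE.
by rewrite trmxK trmx0.
Qed.

(** The singularity (t - s)^(alpha - 1) is integrable, so bounded factors do no harm. The upper
    endpoint [t] is arbitrary because admissibility concerns every time in the interval. *)
Lemma integrable_Phi_bounded (R : realType) (d n : nat) (alpha a b t : R)
    (A : 'M[R]_d) (g : R -> R) (f : R -> 'M[R]_(d, n)) (K : R) :
  0 < alpha -> alpha < 1 -> a < b -> {within `[a, b], continuous g} ->
  a <= t -> t <= b -> (forall i j, measurable_fun `[a, t] (fun s => f s i j)) ->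
  (forall s, s \in `[a, t] -> forall i j, `|f s i j| <= K) ->
  mx_integrable lebesgue_measure `[a, t] (fun s => Phi alpha A g s t *m f s).
Proof.
move=> a0 a1 ab cg at0 tb mf fK i j.
have [C C0 H] := Phi_entryE_le A a0 a1 ab cg.
have mPhi k l := measurable_Phi_entry A k l a0 a1 ab cg tb.
pose c := \sum_(k < d) C * K.
have mh : measurable_fun `[a, t] (fun s => c * (t - s) `^ (alpha - 1)).
  apply: measurable_funM => //; apply: measurable_fun_powRr.
  exact: measurable_funB.
have mab : measurable (`[a, t]%classic : set (measurableTypeR R)) by [].
have mPf : measurable_fun `[a, t] (fun s => (Phi alpha A g s t *m f s) i j).
  by apply: measurable_mulmx_entry => k; [exact: mPhi|exact: mf].
have fh s : `[a, t]%classic s ->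
    `|(Phi alpha A g s t *m f s) i j| <= c * (t - s) `^ (alpha - 1).
  move=> sat; rewrite mxE (le_trans (ler_norm_sum _ _ _))// mulr_suml.
  apply: ler_sum => k _; rewrite normrM mulrAC ler_pM//; last exact: fK.
  move: sat; rewrite /= in_itv/= => /andP[as0 st].
  by have [] := H s t i k as0 st tb.
have c0 : 0 <= c.
  apply: sumr_ge0 => k _; rewrite mulr_ge0//.
  (* The sign of [K] is read off from the entry of [f] at s = t with the summation index as its
     row. *)
  by apply: le_trans (fK t _ k j); rewrite ?normr_ge0// in_itv/= at0 lexx.
have hK : (\int[lebesgue_measure]_(s in `[a, t]) (c * (t - s) `^ (alpha - 1))%:E <=
    (c * ((t - a) `^ alpha / alpha))%:E)%E.
  under eq_integral do rewrite EFinM.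
  rewrite ge0_integralZl ?lee_fin//; first last.
  - by move=> s _; rewrite lee_fin powR_ge0.
  - by apply/measurable_EFinP; apply: measurable_fun_powRr; exact: measurable_funB.
  rewrite [leRHS]EFinM; apply: lee_wpmul2l; first by rewrite lee_fin.
  exact: integral_powR_subr_le.
by have [] := @normr_Rintegral_dominated _ (measurableTypeR R) R lebesgue_measure
  _ _ _ _ mab mPf mh fh hK.
Qed.

(* The control is the one minimising the weighted energy, obtained by applying
   the adjoint of the end-point map to [gramian^-1 (yb - Psi b y0)]. *)
Lemma gramian_controllable (R : realType) (d N : nat) (alpha a b : R)
    (A : 'M[R]_d) (B : 'M[R]_(d, N)) (g : R -> R) (y0 : 'cV[R]_d) :
  0 < alpha -> alpha < 1 -> a < b -> {within `[a, b], continuous g} ->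
  A^T = A -> gramian alpha a b A B g \in unitmx ->
  controllable alpha a b A B g y0.
Proof.
move=> a0 a1 ab cg As Wunit yb.
set W := gramian _ _ _ _ _ _ in Wunit *.
pose v := invmx W *m (yb - Psi alpha a A g b *m y0).
pose Q := weighted_observation alpha b A B g.
pose w t := (b - t) `^ (1 - alpha).
(* By symmetry of [Phi], the extra factor [w] turns [Phi] times [B] into the transpose of [Q], so
   the integrand at time [b] becomes Q^T Q v. *)
pose u t := w t *: (Q t *m v).
have mab : measurable (`[a, b]%classic : set (measurableTypeR R)) by [].
have mw : measurable_fun `[a, b] w.
  by apply: measurable_fun_powRr; exact: measurable_funB.
have mu j : measurable_fun `[a, b] (fun t => u t j 0).
  rewrite (_ : (fun t => _) = (fun t => w t * (Q t *m v) j 0)); last first.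
    by apply/funext => t; rewrite mxE.
  apply: measurable_funM => //; apply: measurable_mulmx_entry => // k.
  exact: measurable_weighted_observation.
have [K K0 QK] := weighted_observation_bounded A B a0 a1 ab cg.
pose L := \sum_i `|v i 0|.
have uL t : t \in `[a, b] -> forall j, `|u t j 0| <= (b - a) `^ (1 - alpha) * (K * L).
  move=> tab j; rewrite mxE normrM ler_pM//.
  - rewrite ger0_norm ?powR_ge0// ge0_ler_powR ?nnegrE ?subr_ge0 ?(ltW a1)//.
    + by move: tab; rewrite in_itv/= => /andP[].
    + exact: ltW.
    + by move: tab; rewrite in_itv/= => /andP[at0 _]; rewrite lerD2l lerN2.
  - rewrite mxE (le_trans (ler_norm_sum _ _ _))// mulr_sumr.
    by apply: ler_sum => k _; rewrite normrM ler_wpM2r// QK.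
pose M := (\sum_i \sum_k `|B i k|) * ((b - a) `^ (1 - alpha) * (K * L)).
have L0 : 0 <= (b - a) `^ (1 - alpha) * (K * L).
  by rewrite !mulr_ge0 ?powR_ge0 ?sumr_ge0.
have iu t : t \in `[a, b] ->
    mx_integrable lebesgue_measure `[a, t] (control_integrand alpha A B g u t).
  rewrite in_itv/= => /andP[at0 tb].
  have sub : `[a, t] `<=` `[a, b].
    by move=> s; rewrite /= !in_itv/= => /andP[-> /le_trans]; apply.
  have -> : control_integrand alpha A B g u t =
      (fun s => Phi alpha A g s t *m (B *m u s)).
    by apply/funext => s; rewrite /control_integrand mulmxA.
  apply: (integrable_Phi_bounded (K := M) A a0 a1 ab cg at0 tb) =>
    [i j|s /sub sab i j].
    apply: measurable_mulmx_entry => // k; rewrite (ord1 j).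
    exact: measurable_funS mab sub (mu k).
  rewrite (ord1 j) (le_trans (mulmx_entry_le _ _ (uL s sab)))//.
  rewrite ler_wpM2r// (bigD1 i)//= lerDl sumr_ge0// => k _; exact: sumr_ge0.
exists u; split; first split => // t tab i; first exact: iu.
rewrite control_solutionE.
have -> : mx_Rintegral lebesgue_measure `[a, b] (control_integrand alpha A B g u b) =
    mx_Rintegral lebesgue_measure `[a, b] (fun t => (Q t)^T *m Q t *m v).
  apply: eq_mx_Rintegral => t; rewrite /= in_itv/= => /andP[at0 tb].
  rewrite /control_integrand /u -scalemxAr -mulmxA scalemxAl; congr (_ *m _).
  rewrite /Q /weighted_observation [in RHS]linearZ/= trmx_mul trmxK.
  by rewrite (Phi_sym a0 a1 ab cg As at0 tb (lexx b)).
rewrite mx_Rintegral_mulr//; last exact: gramian_integrable.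
(* The control contributes W v, which is [yb] minus the free evolution of [y0]. *)
rewrite -/(gramian alpha a b A B g) -/W /v mulmxA mulmxV// mul1mx.
by rewrite addrC subrK.
Qed.

Theorem theorem3p7 (R : realType) (d N : nat) (alpha a b : R)
    (A : 'M[R]_d) (B : 'M[R]_(d, N)) (g : R -> R) (y0 : 'cV[R]_d)
    (alpha_gt0 : 0 < alpha) (alpha_lt1 : alpha < 1) (ltab : a < b)
    (A_sym : A^T = A)
    (g_cont : {within `[a, b], continuous g})
    (g_neq0 : {ae lebesgue_measure, forall t, t \in `[a, b] -> g t != 0}) :
  controllable alpha a b A B g y0 <-> observable alpha a b A B g.
Proof.
split=> [ctrl|obs].
- by apply/observableP => //; exact: controllable_gramian ctrl.
- by apply: gramian_controllable => //; exact/observableP.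
Qed.
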